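(* For every odd integer $t\geq 7$, \[ \mathrm{La}(n,\mathcal{O}_{2t})=(1+o(1))\binom{n}{\lfloor n/2\rfloor}\qquad (n\to\infty). \]
   Context: For posets $P=(P,\le)$ and $P'=(P',\le')$, $P'$ is a (weak) subposet of $P$ if there is an injection $f\colon P'\to P$ such that $u\le' v$ implies $f(u)\le f(v)$. A family $\mathcal{F}$ of subsets of $[n]=\{1,\dots,n\}$ is $P$-free if $P$ is not a weak subposet of $(\mathcal{F},\subseteq)$. $\mathrm{La}(n,P)$ denotes the largest size of a $P$-free family of subsets of $[n]$. For $t\ge 2$, the crown $\mathcal{O}_{2t}$ is the height-2 poset whose Hasse diagram is a cycle of length $2t$ (i.e. elements $a_1,\dots,a_t$ (minimal) and $b_1,\dots,b_t$ (maximal) with $a_i<b_i$ and $a_{i+1}<b_i$, indices mod $t$, and no other relations). *)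

(* Defs.v *)
From mathcomp Require Import all_boot all_order all_algebra.
Set Implicit Arguments. Unset Strict Implicit. Unset Printing Implicit Defensive.
Import Order.TTheory GRing.Theory Num.Theory.

(* The crown O_{2t}: minimal elements a_i = inl i, maximal elements b_i = inr i
   (i : 'I_t), with relations a_i < b_i and a_{i+1} < b_i (indices mod t).
   [has_crown t F] holds iff O_{2t} is a weak subposet of (F, \subset):
   there is an injection f from the 2t crown elements into F preserving
   every relation of the crown. *)
Definition has_crown (t n : nat) (F : {set {set 'I_n}}) : bool :=
  [exists f : {ffun 'I_t + 'I_t -> {set 'I_n}},
     [&& injectiveb f,
         [forall x, f x \in F] &
         [forall i : 'I_t,
            (f (inl i) \subset f (inr i)) &&
            (f (inl (ordS i)) \subset f (inr i))]]].

Definition La_crown (t n : nat) : nat :=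
  \max_(F : {set {set 'I_n}} | ~~ has_crown t F) #|F|.

(* Main.v *)
Require Import Defs.
From mathcomp Require Import all_boot all_order all_algebra.
From mathcomp Require Import zify ring lra.
Import Order.TTheory GRing.Theory Num.Theory.
Local Open Scope ring_scope.

(* Weight a set M by 1 / C(n, |M|), so that a family F has total weight L equal
   to the mean number of its members on a random maximal chain. A crown-free F
   contains no complete bipartite pair of t sets below and t sets above some M,
   so once the K lowest and K highest levels are discarded, pairs of members at
   distance at least 2 on a random chain contribute only O(t / K) (L + 1). Hence
   L <= 1 + p + O(t / K) (L + 1), where p is the mean number of pairs of members
   on consecutive levels, and L >= 1 + eps / 2 makes p a positive proportion of L.

   For x, y, z in B whose removal yields members of F, the set S = B - {x, y, z}
   sees B as a triple of its link all of whose three pairs lie in the link.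
   Double counting yields an S with at least c m W_S > 0 such triples, m being
   the size of the complement of S and W_S the number of pairs in its link.
   A graph with W edges has at most W^(3/2) triangles, so the triples of that S
   have positive density, hence contain a complete 3-partite 3-graph with parts
   of size t, and for odd t >= 7 the levels |S| + 2 and |S| + 3 of such a
   structure contain the crown. *)

(** * Averages over random chains *)

Lemma bin_le_half (n k : nat) : ('C(n, k) <= 'C(n, n./2))%N.
Proof.
have up j : (j < n./2)%N -> ('C(n, j) <= 'C(n, j.+1))%N.
  move=> jn; rewrite -(leq_pmul2l (ltn0Sn j)) mul_bin_left leq_mul2r.
  by apply/orP; right; lia.
have low j : (j <= n./2)%N -> ('C(n, j) <= 'C(n, n./2))%N.
  move=> jn; rewrite -(subKn jn); elim: (n./2 - j)%N (leq_subr j n./2) => [|d IH] dn.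
    by rewrite subn0.
  apply: leq_trans (IH _); last exact: ltnW.
  by have -> : (n./2 - d = (n./2 - d.+1).+1)%N; [lia | apply: up; lia].
have [kn|nk] := leqP k n; last by rewrite bin_small.
have [/low//|nk] := leqP k n./2.
rewrite -bin_sub //; have [/low//|] := leqP (n - k) n./2; lia.
Qed.

(** Both sides count the sets of size [s + k] with an ordered choice of [k] of their elements; on
    the right the other [s] elements are chosen first. *)
Lemma bin_mul_ffact (n s k : nat) :
  ('C(n, s + k) * (s + k) ^_ k = 'C(n, s) * (n - s) ^_ k)%N.
Proof.
elim: k => [|k IH]; first by rewrite addn0.
rewrite addnS ffactSS mulnA [('C(n, _) * _)%N]mulnC mul_bin_left -mulnA IH.
by rewrite ffactnSr subnDA mulnC mulnA.
Qed.

Definition lym_weight {T : finType} (M : {set T}) : rat :=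
  ('C(#|T|, #|M|))%:R^-1.

(** The mean of [f] at the set just before [M] on a random chain through [M]. At [set0] the division
    by 0 gives the value 0. *)
Definition avg_down {T : finType} (f : {set T} -> rat) (M : {set T}) : rat :=
  (\sum_(x in M) f (M :\ x)) / #|M|%:R.

Definition avg_up {T : finType} (f : {set T} -> rat) (M : {set T}) : rat :=
  (\sum_(x in ~: M) f (x |: M)) / #|~: M|%:R.

Lemma lym_weight_gt0 {T : finType} (M : {set T}) : 0 < lym_weight M.
Proof. by rewrite invr_gt0 ltr0n bin_gt0 max_card. Qed.

(** Each side is the probability that a random chain passes through [S] and then adds the elements
    of [U] in one prescribed order. *)
Lemma lym_weight_setU {T : finType} (S U : {set T}) : [disjoint S & U] ->
  lym_weight (S :|: U) / (#|S :|: U| ^_ #|U|)%:R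
  = lym_weight S / (#|~: S| ^_ #|U|)%:R.
Proof.
move=> dSU; rewrite /lym_weight -!invfM -!natrM; congr (_%:R^-1).
rewrite cardsU (disjoint_setI0 dSU) cards0 subn0 bin_mul_ffact.
by rewrite [#|~: S|]cardsCs setCK.
Qed.

Lemma sum_lym_shift {T : finType} (U : {set T}) (f : {set T} -> rat) :
  \sum_(B : {set T} | U \subset B) lym_weight B / (#|B| ^_ #|U|)%:R * f (B :\: U)
  = \sum_(S : {set T} | [disjoint S & U]) lym_weight S / (#|~: S| ^_ #|U|)%:R * f S.
Proof.
rewrite (reindex_onto (fun S => S :|: U) (fun B => B :\: U)) /=; last first.
  move=> B UB; apply/setP => x; rewrite !inE.
  by case: (boolP (x \in U)) => [/(subsetP UB)->|]; rewrite ?orbT ?orbF.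
have dis S : (U \subset S :|: U) && ((S :|: U) :\: U == S) = [disjoint S & U].
  by rewrite subsetUr setDUl setDv setU0 /=; apply/eqP/setDidPl.
rewrite (eq_bigl _ _ dis); apply: eq_bigr => S dSU.
by rewrite lym_weight_setU // setDUl setDv setU0 (setDidPl dSU).
Qed.

(** Both sides sum [g S x] over the steps from [S] to [x |: S], weighted by the probability that a
    random chain takes the step. *)
Lemma sum_lym_exchange {T : finType} (g : {set T} -> T -> rat) :
  \sum_M lym_weight M * ((\sum_(x in M) g (M :\ x) x) / #|M|%:R)
  = \sum_M lym_weight M * ((\sum_(x in ~: M) g M x) / #|~: M|%:R).
Proof.
transitivity (\sum_x \sum_(M : {set T} | [set x] \subset M)
    lym_weight M / (#|M| ^_ #|[set x]|)%:R * g (M :\: [set x]) x).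
  under eq_bigr => M _ do rewrite mulr_suml mulr_sumr.
  rewrite (exchange_big_dep predT) //=; apply: eq_bigr => x _.
  by apply: eq_big => [M|M _]; rewrite ?sub1set // cards1 ffactn1 mulrA mulrAC.
under eq_bigr => x _ do rewrite (sum_lym_shift [set x] (g^~ x)).
under [RHS]eq_bigr => M _ do rewrite mulr_suml mulr_sumr.
rewrite [RHS](exchange_big_dep predT) //=; apply: eq_bigr => x _.
apply: eq_big => [M|M _]; first by rewrite disjoint_sym disjoints1 inE.
by rewrite cards1 ffactn1 mulrA mulrAC.
Qed.

Lemma avg_adjoint {T : finType} (f h : {set T} -> rat) :
  \sum_M lym_weight M * (h M * avg_down f M)
  = \sum_M lym_weight M * (f M * avg_up h M).
Proof.
transitivity (\sum_M lym_weight M *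
    ((\sum_(x in M) f (M :\ x) * h (x |: (M :\ x))) / #|M|%:R)).
  apply: eq_bigr => M _; congr (_ * _); rewrite mulrA mulr_sumr; congr (_ / _).
  by apply: eq_bigr => x xM; rewrite setD1K // mulrC.
rewrite (sum_lym_exchange (fun S x => f S * h (x |: S))).
by apply: eq_bigr => M _; rewrite -mulr_sumr -mulrA.
Qed.

Lemma avg_down_le {T : finType} (f h : {set T} -> rat) (M : {set T}) :
  (forall x, x \in M -> f (M :\ x) <= h (M :\ x)) -> avg_down f M <= avg_down h M.
Proof. by move=> fh; apply: ler_wpM2r; [rewrite invr_ge0|apply: ler_sum]. Qed.

Lemma avg_up_le {T : finType} (f h : {set T} -> rat) (M : {set T}) :
  (forall x, x \notin M -> f (x |: M) <= h (x |: M)) -> avg_up f M <= avg_up h M.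
Proof.
move=> fh; apply: ler_wpM2r; [by rewrite invr_ge0|apply: ler_sum => x].
by rewrite inE; apply: fh.
Qed.

Lemma avg_downD {T : finType} (f h : {set T} -> rat) (M : {set T}) :
  avg_down (fun N => f N + h N) M = avg_down f M + avg_down h M.
Proof. by rewrite /avg_down big_split mulrDl. Qed.

Lemma avg_upZ {T : finType} (c : rat) (f : {set T} -> rat) (M : {set T}) :
  avg_up (fun N => c * f N) M = c * avg_up f M.
Proof. by rewrite /avg_up -mulr_sumr mulrA. Qed.

Lemma avg_upB {T : finType} (f h : {set T} -> rat) (M : {set T}) :
  avg_up (fun N => f N - h N) M = avg_up f M - avg_up h M.
Proof. by rewrite /avg_up sumrB mulrBl. Qed.

Lemma avg_down_cst {T : finType} (c : rat) (M : {set T}) :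
  avg_down (fun=> c) M = if M == set0 then 0 else c.
Proof.
rewrite /avg_down sumr_const; have [->|M0] := eqVneq M set0.
  by rewrite cards0 mulr0n mul0r.
by rewrite -[c *+ _]mulr_natr mulfK // pnatr_eq0 cards_eq0.
Qed.

Lemma avg_up_cst {T : finType} (c : rat) (M : {set T}) :
  avg_up (fun=> c) M = if M == setT then 0 else c.
Proof.
rewrite /avg_up sumr_const; have [->|M0] := eqVneq M setT.
  by rewrite setCT cards0 mulr0n mul0r.
by rewrite -[c *+ _]mulr_natr mulfK // pnatr_eq0 cards_eq0 -setCT (inj_eq (@setC_inj T)).
Qed.

Lemma lym_weightT {T : finType} : lym_weight [set: T] = 1.
Proof. by rewrite /lym_weight cardsT binn invr1. Qed.

(** The increments of [f] telescope along a random chain; nothing is subtracted at [set0], where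
    [avg_down] is 0. *)
Lemma sum_lym_subr_avg_down {T : finType} (f : {set T} -> rat) :
  \sum_M lym_weight M * (f M - avg_down f M) = f setT.
Proof.
under eq_bigr => M _ do rewrite mulrBr -[avg_down f M]mul1r.
rewrite sumrB (avg_adjoint f (fun=> 1)) -sumrB.
rewrite (bigD1 setT) //= big1 => [|M MT]; rewrite avg_up_cst.
  by rewrite eqxx lym_weightT; ring.
by rewrite (negbTE MT); ring.
Qed.

(** * Hitting probabilities of a family *)

Fixpoint hit_rec {T : finType} (F : {set {set T}}) (k : nat) (M : {set T}) : rat :=
  if M \in F then 1 else
  if k is k'.+1 then avg_down (hit_rec F k') M else 0.

(* The probability that a uniformly random maximal chain from [set0] to [M]
   contains a member of [F]. *)
Definition hit {T : finType} (F : {set {set T}}) (M : {set T}) : rat :=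
  hit_rec F #|M| M.

(** Each removal lowers the cardinality and the fuel by one, so the fuel [#|M|] suffices; at [set0]
    outside [F] both sides are 0. *)
Lemma hitE {T : finType} (F : {set {set T}}) (M : {set T}) :
  hit F M = if M \in F then 1 else avg_down (hit F) M.
Proof.
rewrite {1}/hit; case eM: #|M| => [|k] /=.
  by move/cards0_eq: eM => ->; rewrite /avg_down big_set0 mul0r.
case: ifP => // _; rewrite /avg_down; congr (_ / _); apply: eq_bigr => x xM.
by rewrite /hit; move: eM; rewrite (cardsD1 x) xM add1n => -[->].
Qed.

Lemma hit_ge0_le1 {T : finType} (F : {set {set T}}) (M : {set T}) :
  0 <= hit F M <= 1.
Proof.
have [k] := ubnP #|M|; elim: k M => // k IH M Mk; rewrite hitE.
case: ifP => // _.
have IHx x : x \in M -> 0 <= hit F (M :\ x) <= 1.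
  by move=> xM; apply: IH; move: Mk; rewrite (cardsD1 x) xM; lia.
apply/andP; split; first by apply: divr_ge0 => //; apply: sumr_ge0 => x /IHx/andP[].
apply: le_trans (_ : avg_down (fun=> 1) M <= 1).
  by apply: avg_down_le => x /IHx/andP[].
by rewrite avg_down_cst; case: ifP.
Qed.

Lemma avg_down_hit_le1 {T : finType} (F : {set {set T}}) (M : {set T}) :
  0 <= avg_down (hit F) M <= 1.
Proof.
apply/andP; split.
  by apply: divr_ge0 => //; apply: sumr_ge0 => x _; case/andP: (hit_ge0_le1 F (M :\ x)).
apply: le_trans (_ : avg_down (fun=> 1) M <= 1).
  by apply: avg_down_le => x _; case/andP: (hit_ge0_le1 F (M :\ x)).
by rewrite avg_down_cst; case: ifP.
Qed.

Definition below {T : finType} (F : {set {set T}}) (M : {set T}) :=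
  [set A in F | A \proper M].

Definition above {T : finType} (F : {set {set T}}) (M : {set T}) :=
  [set A in F | M \proper A].

(* A fixed nonempty proper subset of [M] lies on a random chain to [M] with
   probability at most [1 / #|M|]. *)
Lemma avg_down_hit_le {T : finType} (F : {set {set T}}) (M : {set T}) :
  set0 \notin F -> avg_down (hit F) M <= #|below F M|%:R / #|M|%:R.
Proof.
move=> F0; have [k] := ubnP #|M|; elim: k M => // k IH M Mk.
apply: ler_wpM2r; first by rewrite invr_ge0.
(* [c A x] is the share of [A] in a union bound for chains to [M :\ x]: 1 if [A] is that set,
   otherwise the bound of the induction hypothesis. *)
pose c (A : {set T}) x : rat := if A == M :\ x then 1 else (#|M|.-1)%:R^-1.
have step x : x \in M ->
    hit F (M :\ x) <= \sum_(A in below F M | x \notin A) c A x.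
  move=> xM; have cx : #|M :\ x| = #|M|.-1 by rewrite (cardsD1 x M) xM.
  have c0 A : 0 <= c A x by rewrite /c; case: ifP; rewrite ?invr_ge0.
  rewrite hitE; case: ifP => MF.
    rewrite (bigD1 (M :\ x)) /=; last by rewrite inE MF properD1 // !inE eqxx.
    have -> : c (M :\ x) x = 1 by rewrite /c eqxx.
    by rewrite lerDl sumr_ge0.
  apply: le_trans (IH _ _) _; first by rewrite (cardsD1 x M) xM in Mk.
  rewrite cx mulr_natl -sumr_const.
  rewrite [leRHS]big_mkcond [leLHS]big_mkcond; apply: ler_sum => A _.
  rewrite !inE; case: (boolP (A \in F)) => //= AF.
  case: (boolP (A \proper M :\ x)) => [AM|_]; last by case: ifP.
  rewrite (proper_sub_trans AM (subsetDl _ _)) /=.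
  have := proper_card AM; rewrite cx => Acx.
  case: ifP => [_|]; last first.
    move/negbT; rewrite negbK => xA.
    by move/proper_sub/subsetP/(_ _ xA): AM; rewrite !inE eqxx.
  by rewrite /c; case: eqP => // _; rewrite invf_le1 ?ler1n ?ltr0n; lia.
apply: le_trans (_ : \sum_(x in M) \sum_(A in below F M | x \notin A) c A x <= _).
  exact: ler_sum.
rewrite (exchange_big_dep (mem (below F M))) /=; last by move=> x A _ /andP[].
rewrite -sum1_card natr_sum.
apply: ler_sum => A; rewrite inE => /andP[AF AM].
have A0 : (0 < #|A|)%N by rewrite card_gt0; apply: contraNneq F0 => <-.
have AMc := proper_card AM.
have cMA : #|M :\: A| = (#|M| - #|A|)%N.
  by rewrite cardsD (setIidPr (proper_sub AM)).
rewrite (eq_bigl (mem (M :\: A))) /=; last first.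
  by move=> x; rewrite !inE AF AM andbC.
(* If [A] misses one element of [M], a single [x] contributes, at most 1. Otherwise each of the at
   most [#|M| - 1] elements outside the nonempty [A] contributes [1 / (#|M| - 1)]. *)
have [e|ne] := eqVneq #|A| #|M|.-1.
  apply: le_trans (_ : \sum_(x in M :\: A) 1 <= _).
    apply: ler_sum => x _; rewrite /c; case: ifP => // _.
    by case: (#|M|.-1) => [|m]; rewrite ?invr0 // invf_le1 ?ler1n ?ltr0n.
  by rewrite sumr_const cMA e; have -> : (#|M| - #|M|.-1 = 1)%N by lia.
rewrite (eq_bigr (fun=> (#|M|.-1)%:R^-1)) => [|x]; last first.
  rewrite !inE => /andP[_ xM]; rewrite /c; case: eqP => // e.
  by move: ne; rewrite e (cardsD1 x M) xM eqxx.
rewrite sumr_const cMA -[_ *+ _]mulr_natl ler_pdivrMr ?mul1r ?ler_nat ?ltr0n; lia.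
Qed.

(** Complementation turns chains from [M] up to [setT] into chains from [set0] to [~: M], so the
    facts on [hit] carry over. *)
Definition hit_up {T : finType} (F : {set {set T}}) (M : {set T}) : rat :=
  hit [set A | ~: A \in F] (~: M).

Lemma avg_up_hit_up {T : finType} (F : {set {set T}}) (M : {set T}) :
  avg_up (hit_up F) M = avg_down (hit [set A | ~: A \in F]) (~: M).
Proof.
rewrite /avg_up /avg_down; congr (_ / _); apply: eq_bigr => x _.
by rewrite /hit_up setCU setIC -setDE.
Qed.

Lemma hit_upE {T : finType} (F : {set {set T}}) (M : {set T}) :
  hit_up F M = if M \in F then 1 else avg_up (hit_up F) M.
Proof. by rewrite avg_up_hit_up /hit_up hitE inE setCK. Qed.

Lemma avg_up_hit_up_le {T : finType} (F : {set {set T}}) (M : {set T}) :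
  setT \notin F -> avg_up (hit_up F) M <= #|above F M|%:R / #|~: M|%:R.
Proof.
move=> FT; rewrite avg_up_hit_up.
apply: le_trans (avg_down_hit_le _ _ _) _; first by rewrite inE setC0.
rewrite -(card_imset (below _ _) (@setC_inj T)).
have -> // : [set ~: A | A in below [set A | ~: A \in F] (~: M)] = above F M.
apply/setP => A; apply/imsetP/idP => [[B]|]; rewrite !inE.
  by move=> /andP[BF BM] ->; rewrite BF -properC setCK.
by move=> /andP[AF MA]; exists (~: A); rewrite ?setCK // !inE setCK AF properC.
Qed.

(** A chain has at most one lowest member of [F], and [B] in [F] is the lowest on a chain through it
    with probability [1 - avg_down (hit F) B]. Telescoping [hit] makes this exact. *)
Lemma sum_lym_le {T : finType} (F : {set {set T}}) :
  \sum_(B in F) lym_weight B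
  <= 1 + \sum_(B in F) lym_weight B * avg_down (hit F) B.
Proof.
have := sum_lym_subr_avg_down (hit F).
rewrite (bigID (mem F)) /= [X in _ + X]big1 => [|M MF]; last first.
  by rewrite hitE (negbTE MF) subrr mulr0.
under eq_bigr => M MF do rewrite hitE MF mulrBr mulr1.
by rewrite sumrB addr0 => e; case/andP: (hit_ge0_le1 F setT); lra.
Qed.

Lemma below_mono {T : finType} (F : {set {set T}}) (M N : {set T}) :
  M \subset N -> (#|below F M| <= #|below F N|)%N.
Proof.
move=> MN; apply/subset_leq_card/subsetP => A; rewrite !inE => /andP[-> AM] /=.
exact: proper_sub_trans AM MN.
Qed.

(* The first member of a chain above [t] sets of [F] has fewer than [t] sets
   of [F] above it, so that the chain rarely meets [F] again; [sum_lym_high]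
   makes this precise by telescoping the hitting probability from above. *)
Lemma sum_lym_high {T : finType} (F : {set {set T}}) (t : nat) (kappa : rat) :
  0 <= kappa <= 2^-1 ->
  (forall M, (t <= #|below F M|)%N -> avg_up (hit_up F) M <= kappa) ->
  \sum_(B in F) lym_weight B *
      avg_down (fun M => (t <= #|below F M|)%N%:R) B
  <= 2 * kappa.
Proof.
move=> /andP[k0 k1] hup; set H := fun M : {set T} => (t <= #|below F M|)%N.
set h := fun M => (H M)%:R : rat; set u := avg_up (hit_up F).
have HS (M N : {set T}) : M \subset N -> H M -> H N.
  by move=> MN; rewrite /H => /leq_trans -> //; apply: below_mono.
have dh M : 0 <= h M - avg_down h M /\ (~~ H M -> avg_down h M = 0).
  have dH0 : ~~ H M -> avg_down h M = 0.
    move=> HM; rewrite /avg_down big1 ?mul0r // => x xM; rewrite /h.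
    by case: (boolP (H _)) => // /(HS _ _ (subsetDl _ _)); rewrite (negbTE HM).
  split=> //; rewrite {1}/h; case: (boolP (H M)) => [_|/dH0->]; rewrite ?subrr //.
  rewrite subr_ge0; apply: le_trans (_ : avg_down (fun=> 1) M <= 1).
    by apply: avg_down_le => x _; rewrite /h lern1 leq_b1.
  by rewrite avg_down_cst; case: ifP.
have -> : \sum_(B in F) lym_weight B * avg_down h B
        = \sum_M lym_weight M * (h M * avg_up (fun B => (B \in F)%:R) M).
  rewrite -(avg_adjoint h) big_mkcond; apply: eq_bigr => M _.
  by case: ifP; rewrite ?mul1r ?mul0r ?mulr0.
(* At sets of [H], [u] is at most 1/2, so a member [B] has [hit_up F B - u B = 1 - u B >= 1/2],
   while a non-member has difference 0. *)
apply: le_trans (_ : \sum_M lym_weight M * (2 * (h M * (u M - avg_up u M))) <= _).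
  apply: ler_sum => M _; apply: ler_wpM2l; first exact: ltW (lym_weight_gt0 M).
  rewrite /h; case: (boolP (H M)) => HM; rewrite ?mul0r ?mulr0 // !mul1r.
  rewrite {1}/u -avg_upB -avg_upZ; apply: avg_up_le => x _.
  have := hup _ (HS _ _ (subsetUr [set x] M) HM).
  rewrite hit_upE /u; case: ifP => _ /=; lra.
(* Summation by parts moves the difference from [u] to [h], where it is nonnegative, vanishes
   outside [H] and has total mass [h setT]. *)
have -> : \sum_M lym_weight M * (2 * (h M * (u M - avg_up u M)))
        = 2 * \sum_M lym_weight M * (u M * (h M - avg_down h M)).
  transitivity (2 * (\sum_M lym_weight M * (h M * u M)
                     - \sum_M lym_weight M * (h M * avg_up u M))).
    by rewrite -sumrB mulr_sumr; apply: eq_bigr => M _; ring.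
  rewrite -avg_adjoint -sumrB; congr (_ * _); apply: eq_bigr => M _; ring.
rewrite ler_pM2l //.
apply: le_trans (_ : \sum_M kappa * (lym_weight M * (h M - avg_down h M)) <= _).
  apply: ler_sum => M _; rewrite mulrCA; have [d0 dz] := dh M.
  case: (boolP (H M)) => HM; last by rewrite dz // /h (negbTE HM) subrr !mulr0.
  by apply: ler_wpM2r (hup _ HM); rewrite mulr_ge0 // ltW // lym_weight_gt0.
rewrite -mulr_sumr sum_lym_subr_avg_down -[leRHS]mulr1 ler_wpM2l //.
by rewrite /h lern1 leq_b1.
Qed.

(** The set [M] preceding [B] on a chain is a member, which gives the middle sum, or has fewer than
    [t] members below it, so that [hit] is at most [t / K], or has at least [t] below it, which
    [sum_lym_high] makes rare. *)
Lemma sum_lym_le_cover {T : finType} (F : {set {set T}}) (t K : nat) :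
  (0 < K)%N -> (2 * t <= K)%N ->
  (forall A, A \in F -> (K <= #|A|)%N && (K <= #|~: A|)%N) ->
  (forall M, (#|below F M| < t)%N || (#|above F M| < t)%N) ->
  \sum_(B in F) lym_weight B <=
  1 + \sum_(B in F) lym_weight B *
        (#|[set x in B | B :\ x \in F]|%:R / #|B|%:R)
  + t%:R / K%:R * (\sum_(B in F) lym_weight B + 2).
Proof.
move=> K0 tK mid noK; set kappa := t%:R / K%:R.
have F0 : set0 \notin F by apply/negP => /mid; rewrite cards0; lia.
have FT : setT \notin F by apply/negP => /mid; rewrite setCT cards0; lia.
have k0 : 0 <= kappa by apply: divr_ge0.
have k1 : 0 <= kappa <= 2^-1.
  by rewrite k0 /= ler_pdivrMr ?ltr0n // ler_pdivlMl // -natrM ler_nat.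
(* The bound on [m] is asked only for [c > 0]: a set with no member below or above it may lie in the
   discarded levels. *)
have frac (c m : nat) : (c < t)%N -> ((0 < c)%N -> (K <= m)%N) ->
    c%:R / m%:R <= kappa.
  case: c => [|c] ct; first by rewrite mul0r.
  move/(_ isT) => Km; have m0 : (0 < m)%N by exact: leq_trans Km.
  rewrite /kappa ler_pdivrMr ?ltr0n // mulrAC ler_pdivlMr ?ltr0n //.
  by rewrite -!natrM ler_nat leq_mul // ltnW.
have low M : (#|below F M| < t)%N -> avg_down (hit F) M <= kappa.
  move=> Mt; apply: le_trans (avg_down_hit_le _ _ F0) _; apply: frac => //.
  rewrite card_gt0 => /set0Pn[A]; rewrite inE => /andP[/mid/andP[KA _] AM].
  exact: leq_trans KA (ltnW (proper_card AM)).
have high M : (t <= #|below F M|)%N -> avg_up (hit_up F) M <= kappa.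
  move=> Mt; apply: le_trans (avg_up_hit_up_le _ _ FT) _; apply: frac.
    by have := noK M; rewrite ltnNge Mt.
  rewrite card_gt0 => /set0Pn[A]; rewrite inE => /andP[/mid/andP[_ KA] AM].
  by apply: leq_trans KA (ltnW (proper_card _)); rewrite properC.
have hl := sum_lym_high _ _ _ k1 high.
apply: le_trans (sum_lym_le F) _; rewrite mulrDr -!addrA lerD2l.
have {}low M : hit F M <= (M \in F)%:R + (kappa + (t <= #|below F M|)%N%:R).
  rewrite hitE; case: ifP => _; first by rewrite lerDl addr_ge0.
  case: leqP => [_|/low] /=; last by lra.
  by case/andP: (avg_down_hit_le1 F M); lra.
apply: le_trans (_ : \sum_(B in F) (lym_weight B *
        (#|[set x in B | B :\ x \in F]|%:R / #|B|%:R) + (kappa * lym_weight B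
  + lym_weight B * avg_down (fun M => (t <= #|below F M|)%N%:R) B)) <= _).
  apply: ler_sum => B _; rewrite [kappa * _]mulrC -!mulrDr.
  apply: ler_wpM2l; first exact: ltW (lym_weight_gt0 B).
  apply: le_trans (avg_down_le _ (fun M => (M \in F)%:R +
      (kappa + (t <= #|below F M|)%N%:R)) _ (fun x _ => low (B :\ x))) _.
  rewrite (avg_downD (fun M => (M \in F)%:R)) (avg_downD (fun=> kappa)).
  apply: lerD; last apply: lerD => //.
    apply: ler_wpM2r; first by rewrite invr_ge0.
    rewrite -sum1_card natr_sum [leLHS]big_mkcond [leRHS]big_mkcond; apply: ler_sum => x _.
    by rewrite inE; case: (x \in B); case: (_ \in F).
  by rewrite avg_down_cst; case: ifP.
by rewrite !big_split /= -mulr_sumr; lra.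
Qed.

(** * A dense link *)

(** Double counting between sets [B] and the sets [S] left by removing a tuple: for each tuple,
    [sum_lym_shift] applies with [U] its set of entries. *)
Lemma sum_lym_tuples {T : finType} (k : nat)
    (Q : {set T} -> k.-tuple T -> bool) :
  \sum_B lym_weight B * (#|[set t : k.-tuple T | [&& uniq t,
     [set x in t] \subset B & Q (B :\: [set x in t]) t]]|%:R / (#|B| ^_ k)%:R)
  = \sum_S lym_weight S * (#|[set t : k.-tuple T | [&& uniq t,
     [disjoint S & [set x in t]] & Q S t]]|%:R / (#|~: S| ^_ k)%:R).
Proof.
have ct (t : k.-tuple T) : uniq t -> #|[set x in t]| = k.
  by move=> ut; rewrite cardsE (card_uniqP ut) size_tuple.
have cE (A : {set k.-tuple T}) : #|A|%:R = \sum_(t in A) 1 :> rat.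
  by rewrite -sum1_card natr_sum.
transitivity (\sum_(t : k.-tuple T | uniq t) \sum_(B : {set T} | [set x in t] \subset B)
    lym_weight B / (#|B| ^_ #|[set x in t]|)%:R * (Q (B :\: [set x in t]) t)%:R).
  rewrite (exchange_big_dep predT) //=; apply: eq_bigr => B _.
  rewrite mulrCA mulrC cE mulr_sumr.
  rewrite [LHS]big_mkcond [RHS]big_mkcond; apply: eq_bigr => t _.
  rewrite inE; case: (boolP (uniq t)) => //= ut; case: (_ \subset _) => //=.
  by rewrite ct //; case: (Q _ _); rewrite ?mulr1 ?mulr0.
under eq_bigr => t _ do rewrite (sum_lym_shift _ (fun S => (Q S t)%:R)).
rewrite (exchange_big_dep predT) //=; apply: eq_bigr => B _.
rewrite mulrCA [RHS]mulrC cE mulr_sumr.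
rewrite [LHS]big_mkcond [RHS]big_mkcond; apply: eq_bigr => t _.
rewrite inE; case: (boolP (uniq t)) => //= ut; case: (disjoint _ _) => //=.
by rewrite ct //; case: (Q _ _); rewrite ?mulr1 ?mulr0.
Qed.

Definition link_pairs {T : finType} (F : {set {set T}}) (S : {set T}) :=
  [set t : 2.-tuple T | [&& uniq t, [disjoint S & [set x in t]]
     & S :|: [set x in t] \in F]].

Definition link_triples {T : finType} (F : {set {set T}}) (S : {set T}) :=
  [set t : 3.-tuple T | [&& uniq t, [disjoint S & [set x in t]]
     & (S :|: [set x in t] \in F)
       && [forall x in t, S :|: ([set y in t] :\ x) \in F]]].

(** For [d <= delta * b / 2] the left side is not positive. Otherwise [d > 4], whence
    [d ^_ 3 >= d^3 / 4 >= delta^3 * b^3 / 32]. A bound linear in [d / b] can be averaged over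
    [B]. *)
Lemma ffact3_ratio (delta : rat) (d b : nat) :
  0 < delta <= 1 -> 8 <= delta * b%:R -> (d <= b)%N ->
  delta ^+ 3 / 32 * (d%:R / b%:R - delta / 2) <= (d ^_ 3)%:R / (b ^_ 3)%:R.
Proof.
move=> /andP[d0 d1] b8 db.
have b0 : 0 < b%:R :> rat by rewrite ltr0n lt0n; apply/eqP => b0; move: b8; rewrite b0 mulr0.
have c0 : 0 < delta ^+ 3 / 32 by rewrite divr_gt0 // exprn_gt0.
have [small|big] := lerP (d%:R / b%:R) (delta / 2).
  apply: le_trans (_ : 0 <= _); last by apply: divr_ge0.
  by rewrite pmulr_rle0 // subr_le0.
have dle1 : d%:R / b%:R <= 1 :> rat by rewrite ler_pdivrMr // mul1r ler_nat.
apply: le_trans (_ : delta ^+ 3 / 32 <= _).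
  by rewrite -[leRHS]mulr1 ler_pM2l //; lra.
rewrite ltr_pdivlMr // in big.
have dn : 4 < d%:R :> rat by lra.
have dn3 : (4 < d)%N by rewrite -(ltr_nat rat).
have bn3 : (0 < b ^_ 3)%N by rewrite ffact_gt0; lia.
rewrite ler_pdivlMr ?ltr0n //.
have -> : (d ^_ 3)%:R = d%:R * (d%:R - 1) * (d%:R - 2) :> rat.
  rewrite !ffactnS ffactn0 muln1 -subn1 -subn1 -subnDA mulnA !natrM !natrB //; lia.
apply: le_trans (_ : delta ^+ 3 / 32 * b%:R ^+ 3 <= _).
  rewrite ler_pM2l // -natrX ler_nat !ffactnS ffactn0 muln1 !expnS expn0 muln1.
  by rewrite !leq_mul //; lia.
set D : rat := d%:R in big dn *; set B : rat := b%:R in big b8 b0 *.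
have -> : delta ^+ 3 / 32 * B ^+ 3 = (delta / 2 * B) ^+ 3 / 4 by field.
apply: le_trans (_ : D ^+ 3 / 4 <= _).
  by rewrite ler_pM2r // lerXn2r ?nnegrE //; nra.
have -> : D ^+ 3 / 4 = D * (D / 2) * (D / 2) by field.
by rewrite !ler_pM ?mulr_ge0 //; lra.
Qed.

(* Only the densities of pairs and triples in the links are compared, so that
   the levels carrying [F] may themselves be sparse. *)
Lemma exists_dense_link {T : finType} (F : {set {set T}}) (delta : rat) (K : nat) :
  0 < delta <= 1 -> 8 <= delta * K%:R -> (forall A, A \in F -> (K <= #|A|)%N) ->
  F != set0 ->
  delta * \sum_(B in F) lym_weight B <= \sum_(B in F) lym_weight B *
        (#|[set x in B | B :\ x \in F]|%:R / #|B|%:R) ->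
  exists S : {set T},
    delta ^+ 4 / 128 * (#|link_pairs F S|%:R / (#|~: S| ^_ 2)%:R)
    < #|link_triples F S|%:R / (#|~: S| ^_ 3)%:R.
Proof.
move=> d01 K8 FK F0 dens; have /andP[d0 d1] := d01.
set L := \sum_(B in F) lym_weight B in dens.
have L0 : 0 < L.
  case/set0Pn: F0 => A AF; rewrite /L (bigD1 A) //= ltr_pwDl ?lym_weight_gt0 //.
  by apply: sumr_ge0 => B _; exact/ltW/lym_weight_gt0.
have K8n : (8 <= K)%N.
  rewrite -(ler_nat rat); apply: le_trans K8 _.
  by rewrite -[leRHS]mul1r ler_wpM2r.
(* Every ordered pair of distinct elements of a member [B] is a link pair of the set it leaves, so
   each member contributes density 1. *)
have e2 : \sum_S lym_weight S * (#|link_pairs F S|%:R / (#|~: S| ^_ 2)%:R) = L.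
  rewrite -(sum_lym_tuples 2 (fun S t => S :|: [set x in t] \in F)).
  rewrite /L [RHS]big_mkcond; apply: eq_bigr => B _.
  rewrite (eq_card (B := [pred t : 2.-tuple T |
    [&& all (mem B) t, uniq t & B \in F]])); last first.
    move=> t; rewrite !inE; case: (boolP (uniq t)) => ut; rewrite ?andbF //=.
    have -> : ([set x in t] \subset B) = all (mem B) t.
      apply/subsetP/allP => h x; first by move=> xt; apply: h; rewrite inE.
      by rewrite inE; exact: h.
    case: (boolP (all _ _)) => //= /allP h.
    congr (_ \in F); apply/setP => x; rewrite !inE.
    by case: (boolP (x \in t)) => [/h /= ->|]; rewrite ?orbT ?orbF.
  case: (boolP (B \in F)) => BF; last first.
    by rewrite eq_card0 ?mul0r ?mulr0 // => t; rewrite !inE !andbF.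
  rewrite (eq_card (B := [set t : 2.-tuple T | all (mem B) t & uniq t])); last first.
    by move=> t; rewrite !inE andbT.
  rewrite card_uniq_tuples divff ?mulr1 // pnatr_eq0 -lt0n ffact_gt0.
  by apply: leq_trans (FK _ BF); apply: leq_trans K8n.
(* A triple in a member [B] is a link triple of the set it leaves exactly when removing any one of
   its entries from [B] gives a member. *)
have e3 : \sum_S lym_weight S * (#|link_triples F S|%:R / (#|~: S| ^_ 3)%:R)
    = \sum_(B in F) lym_weight B *
       ((#|[set x in B | B :\ x \in F]| ^_ 3)%:R / (#|B| ^_ 3)%:R).
  rewrite -(sum_lym_tuples 3 (fun S t => (S :|: [set x in t] \in F)
       && [forall x in t, S :|: ([set y in t] :\ x) \in F])).
  rewrite [RHS]big_mkcond; apply: eq_bigr => B _; set D := [set x in B | _].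
  rewrite (eq_card (B := [pred t : 3.-tuple T |
    [&& all (mem D) t, uniq t & B \in F]])); last first.
    move=> t; rewrite !inE; case: (boolP (uniq t)) => ut; rewrite ?andbF //=.
    have -> : ([set x in t] \subset B) = all (mem B) t.
      apply/subsetP/allP => h x; first by move=> xt; apply: h; rewrite inE.
      by rewrite inE; exact: h.
    have DB : all (mem D) t -> all (mem B) t.
      by move=> /allP h; apply/allP => x /h /=; rewrite inE => /andP[].
    case: (boolP (all (mem B) t)) => /= [/allP h|nB]; last first.
      by case: (boolP (all (mem D) t)) => // /DB; rewrite (negbTE nB).
    have -> : B :\: [set x in t] :|: [set x in t] = B.
      apply/setP => x; rewrite !inE.
      by case: (boolP (x \in t)) => [/h /= ->|]; rewrite ?orbT ?orbF.
    have BD x : x \in t -> B :\: [set x in t] :|: ([set y in t] :\ x) = B :\ x.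
      move=> xt; apply/setP => y; rewrite !inE; have [->|] := eqVneq y x.
        by rewrite xt.
      by case: (boolP (y \in t)) => [/h /= ->|]; rewrite ?orbT ?orbF.
    rewrite andbC; congr (_ && _); apply/forall_inP/allP => hh x xt.
      have xB : x \in B := h _ xt.
      by rewrite /= inE xB -BD // hh.
    by have := hh _ xt; rewrite /= inE BD // => /andP[].
  case: (boolP (B \in F)) => BF; last first.
    by rewrite eq_card0 ?mul0r ?mulr0 // => t; rewrite !inE !andbF.
  rewrite (eq_card (B := [set t : 3.-tuple T | all (mem D) t & uniq t])); last first.
    by move=> t; rewrite !inE andbT.
  by rewrite card_uniq_tuples.
have ge3 : delta ^+ 4 / 64 * L <= \sum_(B in F) lym_weight B *
       ((#|[set x in B | B :\ x \in F]| ^_ 3)%:R / (#|B| ^_ 3)%:R).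
  apply: le_trans (_ : delta ^+ 3 / 32 * (\sum_(B in F) lym_weight B *
        (#|[set x in B | B :\ x \in F]|%:R / #|B|%:R) - delta / 2 * L) <= _).
    have -> : delta ^+ 4 / 64 * L = delta ^+ 3 / 32 * (delta * L - delta / 2 * L) by field.
    by rewrite ler_pM2l ?lerD2r // divr_gt0 // exprn_gt0.
  rewrite /L mulr_sumr -sumrB mulr_sumr; apply: ler_sum => B BF.
  rewrite [_ / 2 * _]mulrC -mulrBr mulrCA; apply: ler_wpM2l; first exact/ltW/lym_weight_gt0.
  apply: ffact3_ratio => //; last by apply/subset_leq_card/subsetP => x; rewrite inE => /andP[].
  by apply: le_trans K8 _; rewrite ler_pM2l // ler_nat FK.
(* If no [S] worked, summing over [S] would bound the triple density by [delta^4 / 128 * L], against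
   the lower bound [delta^4 / 64 * L] with [L > 0]. *)
apply/existsP; apply: contraTT isT; rewrite negb_exists => /forallP no.
suff : \sum_S lym_weight S * (#|link_triples F S|%:R / (#|~: S| ^_ 3)%:R)
   <= delta ^+ 4 / 128 * L.
  rewrite e3 => le3; have := le_trans ge3 le3.
  have : 0 < delta ^+ 4 * L by rewrite mulr_gt0 // exprn_gt0.
  by lra.
rewrite -e2 mulr_sumr; apply: ler_sum => S _; rewrite [leRHS]mulrCA.
by apply: ler_wpM2l; [exact/ltW/lym_weight_gt0 | rewrite leNgt no].
Qed.

(** * Dense 3-graphs *)

(* The triangles at a vertex of degree [d] number at most [min(d ^ 2, E)], hence
   at most [d * (theta + E / theta)] for every [theta > 0]. *)
Lemma edges_of_triangles {T : finType} (W : rel T) (c m : rat) :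
  0 < c -> 0 < m ->
  c * m * #|[set p | W p.1 p.2]|%:R
    < #|[set p : T * (T * T) | [&& W p.1 p.2.1, W p.1 p.2.2 & W p.2.1 p.2.2]]|%:R ->
  (c * m / 2) ^+ 2 < #|[set p | W p.1 p.2]|%:R.
Proof.
move=> c0 m0; set E := #|_|; set N := #|_| => big.
(* With this choice [2 * theta * E < N <= E * (theta + E / theta)], which leaves
   [theta < E / theta]. *)
set theta := c * m / 2; have th0 : 0 < theta by rewrite divr_gt0 // mulr_gt0.
pose d x := #|[set y | W x y]|.
have dE : E = (\sum_x d x)%N.
  rewrite /E /d -sum1_card (eq_bigl (fun p => W p.1 p.2)) => [|p];
    last by rewrite inE.
  rewrite -(pair_big_dep xpredT (fun x y => W x y) (fun _ _ => 1%N)) /=.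
  by apply: eq_bigr => x _; rewrite -sum1_card; apply: eq_bigl => y; rewrite inE.
pose tr x := #|[set p | [&& W x p.1, W x p.2 & W p.1 p.2]]|.
have NE : N = (\sum_x tr x)%N.
  rewrite /N /tr -sum1_card (eq_bigl (fun p =>
    [&& W p.1 p.2.1, W p.1 p.2.2 & W p.2.1 p.2.2])) => [|p]; last by rewrite inE.
  rewrite -(pair_big_dep xpredT (fun x (p : T * T) =>
    [&& W x p.1, W x p.2 & W p.1 p.2]) (fun _ _ => 1%N)) /=.
  by apply: eq_bigr => x _; rewrite -sum1_card; apply: eq_bigl => y; rewrite inE.
have tr1 x : (tr x <= d x * d x)%N.
  rewrite /d -cardsX; apply/subset_leq_card/subsetP => p; rewrite !inE.
  by case/and3P=> -> ->.
have tr2 x : (tr x <= E)%N.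
  by apply/subset_leq_card/subsetP => p; rewrite !inE; case/and3P.
have trx x : (tr x)%:R <= (d x)%:R * (theta + E%:R / theta) :> rat.
  have [le|gt] := lerP (d x)%:R theta.
    apply: le_trans (_ : (d x)%:R * (d x)%:R <= _); first by rewrite -natrM ler_nat.
    by apply: ler_wpM2l => //; rewrite -[leLHS]addr0 lerD // divr_ge0 // ltW.
  apply: le_trans (_ : E%:R <= _); first by rewrite ler_nat.
  rewrite mulrDr -[leLHS]add0r lerD //; first by rewrite mulr_ge0 // ltW.
  by rewrite mulrCA -[leLHS]mulr1 ler_wpM2l // ler_pdivlMr // mul1r ltW.
have Nle : N%:R <= E%:R * (theta + E%:R / theta) :> rat.
  by rewrite NE {1}dE !natr_sum mulr_suml; apply: ler_sum.
have := lt_le_trans big Nle; rewrite mulrC.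
have [->|E0] := eqVneq E 0%N; first by rewrite !mul0r ltxx.
rewrite ltr_pM2l ?ltr0n ?lt0n // => h.
have : theta < E%:R / theta by move: h; rewrite /theta; lra.
by rewrite ltr_pdivlMr // expr2.
Qed.

Lemma subset_of_card {T : finType} (A : {set T}) (k : nat) :
  (k <= #|A|)%N -> exists2 U : {set T}, U \subset A & #|U| = k.
Proof.
move=> kA; have : (0 < #|[set U : {set T} | (U \subset A) && (#|U| == k)]|)%N.
  by rewrite cards_draws bin_gt0.
by rewrite card_gt0 => /set0Pn[U]; rewrite inE => /andP[UA /eqP]; exists U.
Qed.

Lemma exists_nat_scale (a d : rat) : 0 <= a -> 0 < d ->
  exists2 N : nat, (0 < N)%N & a <= d * N%:R.
Proof.
move=> a0 d0; exists (Num.bound (a / d)).+1 => //.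
rewrite -ler_pdivrMl // mulrC; apply/ltW.
apply: lt_le_trans (archi_boundP _) _; last by rewrite ler_nat.
by rewrite divr_ge0 // ltW.
Qed.

(** Boundedly many vertices of [A] of high degree already have many [y] in [B] joined to [s] of
    them, and pigeonhole over their subsets gives [U]. Neither [delta'] nor [N] depends on [B], so
    [B] may be a set of pairs. *)
Lemma common_neighbours (delta : rat) (s : nat) : 0 < delta ->
  exists2 delta' : rat, 0 < delta' & exists N : nat,
  forall (X Y : finType) (R : X -> Y -> bool) (A : {set X}) (B : {set Y}),
  (N <= #|A|)%N -> B != set0 ->
  delta * #|A|%:R * #|B|%:R <= (\sum_(x in A) #|[set y in B | R x y]|)%:R ->
  exists U : {set X}, [/\ U \subset A, #|U| = s
    & delta' * #|B|%:R <= #|[set y in B | [forall x in U, R x y]]|%:R].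
Proof.
move=> d0.
have [|N0 N0gt N0P] := exists_nat_scale (4 * s%:R) delta _ d0; first by rewrite mulr_ge0.
have [|N1 _ N1P] := exists_nat_scale (2 * N0%:R) delta _ d0; first by rewrite mulr_ge0.
exists (delta / 8 / 2 ^+ N0); first by rewrite !divr_gt0 // exprn_gt0.
exists N1.+1 => X Y R A B NA B0 dens.
have b0 : 0 < #|B|%:R :> rat by rewrite ltr0n card_gt0.
pose deg x := #|[set y in B | R x y]|.
have degB x : (deg x <= #|B|)%N.
  by apply/subset_leq_card/subsetP => y; rewrite inE => /andP[].
pose G := [set x in A | delta / 2 * #|B|%:R <= (deg x)%:R].
have GA : G \subset A by apply/subsetP => x; rewrite inE => /andP[].
have cG : (N0 <= #|G|)%N.
  have : (\sum_(x in A) deg x)%:R <= #|G|%:R * #|B|%:R + delta / 2 * #|A|%:R * #|B|%:R.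
    rewrite natr_sum (bigID (mem G)) /=; apply: lerD.
      rewrite mulr_natl -sumr_const [leLHS]big_mkcond [leRHS]big_mkcond /=.
      apply: ler_sum => x _; case: (boolP (x \in G)) => xG; rewrite ?andbF //.
      by rewrite (subsetP GA) //= ler_nat.
    rewrite mulrAC mulr_natr -sumr_const [leLHS]big_mkcond [leRHS]big_mkcond /=.
    apply: ler_sum => x _; rewrite inE; case: (x \in A) => //=.
    have h0 : 0 <= delta / 2 * #|B|%:R by rewrite !mulr_ge0 // ltW.
    by case: (boolP (_ <= (deg x)%:R)) => /= [_|] //; rewrite -?ltNge => /ltW.
  move=> /(le_trans dens) h.
  have {}h : delta / 2 * #|A|%:R <= #|G|%:R.
    by rewrite -(ler_pM2r b0); lra.
  rewrite -(ler_nat rat); apply: le_trans h.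
  have : delta * N1%:R <= delta * #|A|%:R by rewrite ler_pM2l // ler_nat ltnW.
  by lra.
have [X0 X0G cX0] := subset_of_card _ _ cG.
have X0A := subset_trans X0G GA.
pose nb y := [set x in X0 | R x y].
pose H := [set y in B | (s <= #|nb y|)%N].
(* Of the at least [delta * N0 * #|B| / 2] edges at [X0], those outside [H] number at most
   [s * #|B| <= delta * N0 * #|B| / 4]; each vertex of [H] takes at most [N0]. *)
have cH : delta / 4 * #|B|%:R <= #|H|%:R.
  have N00 : 0 < N0%:R :> rat by rewrite ltr0n.
  have up : (\sum_(y in B) #|nb y|)%:R <= N0%:R * #|H|%:R + s%:R * #|B|%:R :> rat.
    rewrite -!natrM -natrD ler_nat !(mulnC _ #|_|) -!sum_nat_const.
    rewrite [X in (_ <= X + _)%N]big_mkcond [X in (_ <= _ + X)%N]big_mkcond -big_split.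
    rewrite [X in (X <= _)%N]big_mkcond; apply: leq_sum => y _; rewrite inE.
    case: (y \in B) => //=; have : (#|nb y| <= N0)%N.
      by rewrite -cX0; apply/subset_leq_card/subsetP => x; rewrite inE => /andP[].
    by case: (leqP s) => [_ h|/ltnW]; rewrite ?add0n // (leq_trans h) ?leq_addr.
  have low : N0%:R * (delta / 2 * #|B|%:R) <= (\sum_(y in B) #|nb y|)%:R :> rat.
    have -> : (\sum_(y in B) #|nb y| = \sum_(x in X0) deg x)%N.
      transitivity (\sum_(y in B) \sum_(x in X0 | R x y) 1)%N.
        by apply: eq_bigr => y _; rewrite -sum1_card; apply: eq_bigl => x; rewrite inE.
      rewrite (exchange_big_dep (mem X0)) /=; last by move=> y x _ /andP[].
      apply: eq_bigr => x xX0; rewrite /deg -sum1_card; apply: eq_bigl => y.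
      by rewrite inE xX0.
    rewrite natr_sum -cX0 mulr_natl -sumr_const; apply: ler_sum => x xX0.
    by move/subsetP: X0G => /(_ _ xX0); rewrite inE => /andP[].
  have {}up := le_trans low up.
  have sB : 4 * s%:R * #|B|%:R <= delta * N0%:R * #|B|%:R by rewrite ler_pM2r.
  by rewrite -(ler_pM2l N00); lra.
pose com (U : {set X}) := [set y in B | [forall x in U, R x y]].
have [U /and3P[UX0 /eqP cU hU]|none] :=
    pickP (fun U : {set X} => [&& U \subset X0, #|U| == s
      & delta / 8 / 2 ^+ N0 * #|B|%:R <= #|com U|%:R]); last first.
  exfalso.
  (* Each [y] in [H] is a common neighbour of some [s]-subset of [X0]. The at most [2 ^ N0] subsets
     would cover at most [delta / 8 * #|B|], less than [#|H|]. *)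
  have : (#|H| <= \sum_(U in powerset X0 | #|U| == s) #|com U|)%N.
    apply: leq_trans (_ : #|\bigcup_(U in powerset X0 | #|U| == s) com U| <= _)%N.
      apply/subset_leq_card/subsetP => y; rewrite inE => /andP[yB ynb].
      have [U Unb cU] := subset_of_card _ _ ynb.
      apply/bigcupP; exists U.
        rewrite cU eqxx andbT powersetE; apply: subset_trans Unb _.
        by apply/subsetP => x; rewrite inE => /andP[].
      rewrite inE yB; apply/forall_inP => x /(subsetP Unb).
      by rewrite inE => /andP[].
    by apply: (big_ind2 (fun (x : {set Y}) n => #|x| <= n)%N) => [|C c D e Cc De|//];
       rewrite ?cards0 // (leq_trans (leq_card_setU _ _)) ?leq_add.
  rewrite -(ler_nat rat) natr_sum; apply/negP; rewrite -ltNge.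
  apply: le_lt_trans (_ : \sum_(U in powerset X0) delta / 8 / 2 ^+ N0 * #|B|%:R < _).
    rewrite [leLHS]big_mkcondr; apply: ler_sum => U; rewrite powersetE => UX0.
    have h0 : 0 <= delta / 8 / 2 ^+ N0 * #|B|%:R.
      by rewrite mulr_ge0 // !divr_ge0 ?exprn_ge0 // ltW.
    case: ifP => // cU; have := none U; rewrite UX0 cU /=.
    by case: lerP => // /ltW.
  rewrite sumr_const card_powerset cX0 -[_ *+ _]mulr_natl natrX.
  have e0 : 2 ^+ N0 != 0 :> rat by rewrite expf_neq0.
  rewrite mulrC mulrAC divfK //.
  apply: lt_le_trans cH; rewrite ltr_pM2r //; lra.
by exists U; split=> //; exact: subset_trans X0A.
Qed.

(** The case of 3-graphs of Erdős's theorem on complete multipartite subgraphs: [common_neighbours]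
    fixes [X] against pairs, then [Y] against single vertices. Disjointness of the parts comes
    later, from the distinct entries of link triples. *)
Lemma dense_triples_complete (delta : rat) (s : nat) : 0 < delta ->
  exists N : nat, forall (T : finType) (V : {set T}) (P : T -> T -> T -> bool),
  (N <= #|V|)%N ->
  delta * #|V|%:R ^+ 3
    <= #|[set p : T * (T * T) | [&& p.1 \in V, p.2 \in setX V V
            & P p.1 p.2.1 p.2.2]]|%:R ->
  exists X Y Z : {set T}, [/\ #|X| = s, #|Y| = s, #|Z| = s
   & forall x y z, x \in X -> y \in Y -> z \in Z -> P x y z].
Proof.
move=> d0; have [d1 d10 [N1 H1]] := common_neighbours _ s d0.
have [d2 d20 [N2 H2]] := common_neighbours _ s d10.
have [|N3 _ N3P] := exists_nat_scale s%:R d2 _ d20; first by [].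
exists (N1 + N2 + N3).+1 => T V P NV dens.
have V0 : V != set0 by rewrite -card_gt0; lia.
have v0 : 0 < #|V|%:R :> rat by rewrite ltr0n card_gt0.
have [|||X [XV cX hX]] := H1 T (T * T)%type (fun x p => P x p.1 p.2) V (setX V V).
- lia.
- by rewrite -card_gt0 cardsX muln_gt0 card_gt0 V0.
- rewrite cardsX natrM.
  have -> (v : rat) : delta * v * (v * v) = delta * v ^+ 3 by ring.
  apply: le_trans dens _.
  rewrite ler_nat -sum1_card (eq_bigl (fun p => (p.1 \in V) &&
    ((p.2 \in setX V V) && P p.1 p.2.1 p.2.2))) => [|p]; last by rewrite inE.
  rewrite -(pair_big_dep (mem V) (fun x (p : T * T) =>
    (p \in setX V V) && P x p.1 p.2) (fun _ _ => 1%N)) /=.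
  apply: leq_sum => x _; rewrite -sum1_card leq_eqVlt; apply/orP; left; apply/eqP.
  by apply: eq_bigl => y; rewrite inE.
have [|//||Y [YV cY hY]] := H2 T T (fun y z => [forall x in X, P x y z]) V V.
- lia.
- rewrite -mulrA -natrM -cardsX; apply: le_trans hX _; rewrite ler_nat -sum1_card.
  rewrite (eq_bigl (fun p => (p.1 \in V) &&
    ((p.2 \in V) && [forall x in X, P x p.1 p.2]))) => [|p]; last by rewrite !inE andbA.
  rewrite -(pair_big_dep (mem V) (fun x z =>
    (z \in V) && [forall x' in X, P x' x z]) (fun _ _ => 1%N)) /=.
  apply: leq_sum => x _; rewrite -sum1_card leq_eqVlt; apply/orP; left; apply/eqP.
  by apply: eq_bigl => y; rewrite inE.
have [|Z ZV cZ] := subset_of_card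
  [set z in V | [forall y in Y, [forall x in X, P x y z]]] s.
  rewrite -(ler_nat rat); apply: le_trans hY; apply: le_trans N3P _.
  by rewrite ler_pM2l // ler_nat; lia.
exists X, Y, Z; split=> // x y z xX yY zZ.
move/subsetP: ZV => /(_ _ zZ); rewrite inE => /andP[_ /forall_inP/(_ _ yY)].
by move/forall_inP => /(_ _ xX).
Qed.

(** * Complete 3-partite links *)

Lemma link_triplesP {T : finType} (F : {set {set T}}) (S : {set T}) (x y z : T) :
  [tuple x; y; z] \in link_triples F S ->
  [/\ [&& x != y, x != z & y != z], [&& x \notin S, y \notin S & z \notin S]
    , S :|: [set x; y; z] \in F
    & [&& S :|: [set x; y] \in F, S :|: [set x; z] \in F & S :|: [set y; z] \in F]].
Proof.
have e3 : [set u in [tuple x; y; z]] = [set x; y; z].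
  by apply/setP => u; rewrite !inE orbA.
rewrite inE e3 => /and4P[u d FS /forall_inP pairs].
have /and3P[xy xz yz] : [&& x != y, x != z & y != z].
  by move: u; rewrite /= !inE negb_or -andbA andbT.
have out w : w \in [set x; y; z] -> w \notin S.
  by move=> wU; move: d; rewrite disjoint_sym => /disjointFr -> //.
split; rewrite ?xy ?xz ?yz ?out ?inE ?eqxx ?orbT //=.
have pr w A : w \in [tuple x; y; z] -> [set x; y; z] :\ w = A -> S :|: A \in F.
  by move=> /pairs h <-.
apply/and3P; split; [apply: (pr z) | apply: (pr y) | apply: (pr x)];
  rewrite ?inE ?eqxx ?orbT //; apply/setP => w; rewrite !inE.
- have [->|] := eqVneq w z; last by rewrite orbF.
  by rewrite ![z == _]eq_sym (negbTE xz) (negbTE yz).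
- have [->|] := eqVneq w y; last by rewrite orbF.
  by rewrite eq_sym (negbTE xy) (negbTE yz).
- by have [->|] := eqVneq w x; rewrite ?(negbTE xy) ?(negbTE xz).
Qed.

(** Here [m ^_ 3 = m ^_ 2 * (m - 2)], and [m - 2 >= m / 2] accounts for the factor 2. *)
Lemma ffact_ratio_lt (c e d : rat) (m : nat) : (4 <= m)%N -> 0 < c -> 0 <= e ->
  2 * c * (e / (m ^_ 2)%:R) < d / (m ^_ 3)%:R -> c * m%:R * e < d.
Proof.
move=> m4 c0 e0; have m2 : 0 < (m ^_ 2)%:R :> rat by rewrite ltr0n ffact_gt0; lia.
have {}m4 : 4 <= m%:R :> rat by rewrite ler_nat.
have -> : (m ^_ 3)%:R = (m ^_ 2)%:R * (m%:R - 2) :> rat.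
  by rewrite ffactnSr natrM natrB // -(ler_nat rat); lra.
move: (m ^_ 2)%:R m%:R m2 m4 => M v M0 v4.
rewrite ltr_pdivlMr; last by apply: mulr_gt0 => //; lra.
apply: le_lt_trans.
have -> : 2 * c * (e / M) * (M * (v - 2)) = c * (2 * (v - 2)) * e.
  by field; rewrite gt_eqF.
by rewrite ler_wpM2r // ler_pM2l //; lra.
Qed.

(** The dense link has more than [c * m] triples per pair, hence more than [(c * m / 2)^2] pairs and
    more than [c^3 / 4 * m^3] triples. *)
Lemma complete_link (delta : rat) (s : nat) : 0 < delta <= 1 ->
  exists K0 : nat, forall (T : finType) (F : {set {set T}}) (K : nat),
  (K0 <= K)%N ->
  (forall A, A \in F -> (K <= #|A|)%N && (K <= #|~: A|)%N) ->
  F != set0 ->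
  delta * \sum_(B in F) lym_weight B <= \sum_(B in F) lym_weight B *
        (#|[set x in B | B :\ x \in F]|%:R / #|B|%:R) ->
  exists S X Y Z : {set T}, [/\ #|X| = s, #|Y| = s, #|Z| = s
   & forall x y z, x \in X -> y \in Y -> z \in Z ->
       [tuple x; y; z] \in link_triples F S].
Proof.
move=> d01; have /andP[d0 d1] := d01.
(* Half the constant of [exists_dense_link], to pay for the factor 2 in [ffact_ratio_lt]. *)
have [c cE] : exists c, c = delta ^+ 4 / 256 by exists (delta ^+ 4 / 256).
have c0 : 0 < c by rewrite cE divr_gt0 // exprn_gt0.
have c30 : 0 < c ^+ 3 / 4 by rewrite divr_gt0 // exprn_gt0.
have [N HN] := dense_triples_complete _ s c30.
have [//|K1 _ K1P] := exists_nat_scale 8 delta _ d0.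
exists (N + K1 + 6)%N => T F K KK mid F0 dens.
have [NK K1K K6] : [/\ (N <= K)%N, (K1 <= K)%N & (6 <= K)%N] by split; lia.
have [|A|S dS] := exists_dense_link F delta K d01 _ _ F0 dens.
- by apply: le_trans K1P _; rewrite ler_pM2l // ler_nat.
- by case/mid/andP.
exists S; have [m em] : exists m, m = #|~: S| by exists #|~: S|.
rewrite -em in dS.
have T30 : (0 < #|link_triples F S|)%N.
  rewrite lt0n; apply/eqP => e; move: dS; rewrite e mul0r; apply/negP; rewrite -leNgt.
  apply: mulr_ge0; last by apply: divr_ge0; apply: ler0n.
  by apply: divr_ge0 => //; apply/exprn_ge0/ltW.
(* A link triple exists, and the member it forms with [S] has at least [K] elements in its
   complement, all outside [S]. *)
have mK : (K <= m)%N.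
  rewrite em.
  case/card_gt0P: T30 => t; rewrite inE => /and4P[_ _ tF _].
  case/andP: (mid _ tF) => _ /leq_trans; apply; apply: subset_leq_card.
  by rewrite setCS subsetUl.
have m0 : 0 < m%:R :> rat by rewrite ltr0n; apply: leq_trans mK; apply: leq_trans K6.
pose W x y := [tuple x; y] \in link_pairs F S.
pose E := #|[set p | W p.1 p.2]|.
have EE : (E <= #|link_pairs F S|)%N.
  rewrite /E -(card_imset _ (_ : injective (fun p : T * T => [tuple p.1; p.2]))).
    by apply/subset_leq_card/subsetP => t /imsetP[p]; rewrite inE => pW ->.
  by move=> [a b] [a' b'] /(congr1 val) /= [-> ->].
pose Q := [set p : T * (T * T) | [tuple p.1; p.2.1; p.2.2] \in link_triples F S].
have TQ : (#|link_triples F S| <= #|Q|)%N.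
  apply: leq_trans (leq_imset_card (fun p => [tuple p.1; p.2.1; p.2.2]) _).
  apply/subset_leq_card/subsetP => t.
  case/tupleP: t => a t; case/tupleP: t => b t; case/tupleP: t => d t.
  rewrite (tuple0 t); set u := (X in X \in _ -> _) => uL.
  have e : u = [tuple a; b; d] by exact: val_inj.
  apply/imsetP; exists (a, (b, d)); last exact: e.
  by rewrite inE /= -e.
have QW : (#|Q| <=
    #|[set p : T * (T * T) | [&& W p.1 p.2.1, W p.1 p.2.2 & W p.2.1 p.2.2]]|)%N.
  apply/subset_leq_card/subsetP => -[x [y z]]; rewrite [_ \in Q]inE /=.
  move=> /link_triplesP[/and3P[xy xz yz] /and3P[xS yS zS] _ /and3P[Fxy Fxz Fyz]].
  have pr a b : a != b -> a \notin S -> b \notin S -> S :|: [set a; b] \in F -> W a b.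
    move=> ab aS bS Fab; rewrite /W inE /= inE ab /=.
    have -> : [set u in [tuple a; b]] = [set a; b] by apply/setP => u; rewrite !inE.
    rewrite Fab andbT disjoint_sym disjoints_subset; apply/subsetP => u.
    by rewrite !inE => /orP[] /eqP->.
  by rewrite inE /= !pr.
have big : c * m%:R * #|link_pairs F S|%:R < #|link_triples F S|%:R.
  apply: ffact_ratio_lt c0 (ler0n _ _) _; first by apply: leq_trans mK; apply: leq_trans K6.
  suff -> : 2 * c = delta ^+ 4 / 128 by [].
  by rewrite cE; field.
have bigW := edges_of_triangles W c m%:R c0 m0 _.
have {}bigW : (c * m%:R / 2) ^+ 2 < #|link_pairs F S|%:R.
  apply: lt_le_trans (bigW _) _; last by rewrite ler_nat.
  apply: le_lt_trans (_ : c * m%:R * #|link_pairs F S|%:R < _).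
    by rewrite ler_pM2l; [rewrite ler_nat; exact: EE | exact: mulr_gt0].
  by apply: lt_le_trans big _; rewrite ler_nat; apply: leq_trans QW.
apply: (HN T (~: S) (fun x y z => [tuple x; y; z] \in link_triples F S)).
  by rewrite -em (leq_trans NK).
apply: le_trans (_ : #|Q|%:R <= _); last first.
  rewrite ler_nat; apply/subset_leq_card/subsetP => -[x [y z]]; rewrite [_ \in Q]inE /= => h.
  have [_ /and3P[xS yS zS] _ _] := link_triplesP _ _ _ _ _ h.
  by rewrite inE /= h !inE /= xS yS zS.
apply: le_trans (_ : #|link_triples F S|%:R <= _); last by rewrite ler_nat.
apply: ltW; apply: lt_trans big.
have -> : c ^+ 3 / 4 * #|~: S|%:R ^+ 3 = c * m%:R * (c * m%:R / 2) ^+ 2 by rewrite -em; field.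
by rewrite ltr_pM2l // mulr_gt0.
Qed.

(** * Embedding the crown *)

Local Close Scope ring_scope.

Lemma has_crown_map (t n : nat) (F : {set {set 'I_n}})
    (f : 'I_t + 'I_t -> {set 'I_n}) :
  injective f -> (forall u, f u \in F) ->
  (forall i, f (inl i) \subset f (inr i)) ->
  (forall i, f (inl (ordS i)) \subset f (inr i)) -> has_crown t F.
Proof.
move=> finj fF f1 f2; apply/existsP; exists (finfun f); apply/and3P; split.
- by apply/injectiveP => u v; rewrite !ffunE; apply: finj.
- by apply/forallP => u; rewrite ffunE.
- by apply/forallP => i; rewrite !ffunE f1 f2.
Qed.

(** Every member below [M] lies properly inside every member above it, so all relations hold and the
    two sides stay distinct. *)
Lemma has_crown_below_above (t n : nat) (F : {set {set 'I_n}}) (M : {set 'I_n}) :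
  t <= #|below F M| -> t <= #|above F M| -> has_crown t F.
Proof.
move=> tb ta.
pose f (u : 'I_t + 'I_t) := match u with
  | inl i => nth set0 (enum (below F M)) i
  | inr i => nth set0 (enum (above F M)) i end.
have fb (i : 'I_t) : f (inl i) \in below F M.
  by rewrite -mem_enum mem_nth // -cardE (leq_trans (ltn_ord i)).
have fa (i : 'I_t) : f (inr i) \in above F M.
  by rewrite -mem_enum mem_nth // -cardE (leq_trans (ltn_ord i)).
have fp i j : f (inl i) \proper f (inr j).
  have := fb i; have := fa j; rewrite !inE => /andP[_ Mj] /andP[_ iM].
  exact: proper_trans iM Mj.
have nsz (A : {set {set 'I_n}}) (i j : 'I_t) : t <= #|A| ->
    nth set0 (enum A) i = nth set0 (enum A) j -> i = j.
  move=> tA /eqP; rewrite nth_uniq ?enum_uniq -?cardE ?(leq_trans (ltn_ord _)) //.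
  by move/eqP/val_inj.
apply: (@has_crown_map _ _ _ f) => [[i|i] [j|j]|[i|i]|i|i].
- by move/nsz => ->.
- by move=> e; have := fp i j; rewrite e properxx.
- by move=> e; have := fp j i; rewrite e properxx.
- by move/nsz => ->.
- by have := fb i; rewrite inE => /andP[].
- by have := fa i; rewrite inE => /andP[].
- exact: proper_sub.
- exact: proper_sub.
Qed.

(* [(a, b, c)] stands for the link vertices [x_a], [y_b], [z_c] of a complete
   3-partite 3-graph, [None] marking a missing one. The first [2 * l] minimal
   elements of the crown alternate between the pairs [x_j y_0] and [y_0 z_j];
   the last three are [z_(l-1) x_0], [x_0 y_1] and [x_0 z_l], which closes an
   odd cycle. For [l = 1] the maximal elements would not be distinct. *)
Definition crown_pair (l i : nat) : option nat * option nat * option nat :=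
  if i < l.*2 then
    if odd i then (None, Some 0, Some i./2) else (Some i./2, Some 0, None)
  else if i == l.*2 then (Some 0, None, Some l.-1)
  else if i == l.*2.+1 then (Some 0, Some 1, None)
  else (Some 0, None, Some l).

(** Entry [i] is the union of the pairs [i] and [i + 1] of [crown_pair], indices mod [2 * l + 3]. *)
Definition crown_triple (l i : nat) : nat * nat * nat :=
  if i < l.*2.-1 then (uphalf i, 0, i./2)
  else if i == l.*2.-1 then (0, 0, l.-1)
  else if i == l.*2 then (0, 1, l.-1)
  else if i == l.*2.+1 then (0, 1, l)
  else (0, 0, l).

Definition code_of_triple (p : nat * nat * nat) :=
  (Some p.1.1, Some p.1.2, Some p.2).

Definition subcode (p q : option nat * option nat * option nat) :=
  [&& p.1.1 \in [:: None; q.1.1], p.1.2 \in [:: None; q.1.2] & p.2 \in [:: None; q.2]].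

Lemma crown_pair_inj (l i j : nat) : 1 < l -> i < l.*2 + 3 -> j < l.*2 + 3 ->
  crown_pair l i = crown_pair l j -> i = j.
Proof.
rewrite /crown_pair => l1 il jl.
by do !case: ifP => ?; first [discriminate | move=> e; injection e; lia | lia].
Qed.

Lemma crown_triple_inj (l i j : nat) : 1 < l -> i < l.*2 + 3 -> j < l.*2 + 3 ->
  crown_triple l i = crown_triple l j -> i = j.
Proof.
rewrite /crown_triple => l1 il jl.
by do !case: ifP => ?; first [discriminate | move=> e; injection e; lia | lia].
Qed.

Lemma subcode_crown (l i : nat) : 1 < l -> i < l.*2 + 3 ->
  subcode (crown_pair l i) (code_of_triple (crown_triple l i)).
Proof.
move=> l1 il; rewrite /subcode /crown_pair /crown_triple.
by do !case: ifP => ?; rewrite /= ?inE ?eqxx ?orbT //=;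
   repeat (apply/andP; split); rewrite //=; first [exfalso; lia | apply/eqP; congr Some; lia].
Qed.

Lemma subcode_crownS (l i : nat) : 1 < l -> i < l.*2 + 3 ->
  subcode (crown_pair l (i.+1 %% (l.*2 + 3))) (code_of_triple (crown_triple l i)).
Proof.
move=> l1 il; have [->|i1] : i = l.*2.+2 \/ i.+1 < l.*2 + 3 by lia.
  by rewrite addn3 modnn /crown_pair /crown_triple double_gt0 (ltnW l1) /=;
    do !case: ifP => ?; rewrite /subcode /= ?inE ?eqxx //; lia.
rewrite modn_small // /subcode /crown_pair /crown_triple.
by do !case: ifP => ?; rewrite /= ?inE ?eqxx ?orbT //=;
   repeat (apply/andP; split); rewrite //=; first [exfalso; lia | apply/eqP; congr Some; lia].
Qed.

Definition code_bounded (t : nat) (p : option nat * option nat * option nat) :=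
  let bd a := if a is Some k then k < t else true in
  [&& bd p.1.1, bd p.1.2 & bd p.2].

Lemma code_of_triple_inj : injective code_of_triple.
Proof. by move=> [[a b] c] [[a' b'] c'] [-> -> ->]. Qed.

Lemma crown_pair_bounded (l i : nat) : 1 < l -> i < l.*2 + 3 ->
  code_bounded (l.*2 + 3) (crown_pair l i).
Proof.
move=> l1 il; rewrite /code_bounded /crown_pair.
by do !case: ifP => ? /=; lia.
Qed.

Lemma crown_triple_bounded (l i : nat) : 1 < l -> i < l.*2 + 3 ->
  [&& (crown_triple l i).1.1 < l.*2 + 3, (crown_triple l i).1.2 < l.*2 + 3
    & (crown_triple l i).2 < l.*2 + 3].
Proof.
move=> l1 il; rewrite /crown_triple.
by do !case: ifP => ? /=; lia.
Qed.

(** Exactly one class is missing, so any vertex of that class completes the pair to a link triple,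
    and no pair is the code of a triple. *)
Lemma crown_pair_shape (l i : nat) :
  [\/ exists a b, crown_pair l i = (Some a, Some b, None),
      exists a b, crown_pair l i = (Some a, None, Some b)
    | exists a b, crown_pair l i = (None, Some a, Some b)].
Proof.
rewrite /crown_pair; do !case: ifP => _.
- by constructor 3; do 2!eexists.
- by constructor 1; do 2!eexists.
- by constructor 2; do 2!eexists.
- by constructor 1; do 2!eexists.
- by constructor 2; do 2!eexists.
Qed.

(** By [link_triplesP] the three parts are disjoint from each other and from [S], so [vset]
    determines its code, and the crown conditions reduce to those on codes. *)
Lemma has_crown_complete (l n : nat) (F : {set {set 'I_n}}) (S X Y Z : {set 'I_n}) :
  1 < l -> #|X| = l.*2 + 3 -> #|Y| = l.*2 + 3 -> #|Z| = l.*2 + 3 ->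
  (forall x y z, x \in X -> y \in Y -> z \in Z ->
     [tuple x; y; z] \in link_triples F S) ->
  has_crown (l.*2 + 3) F.
Proof.
move=> l1 cX cY cZ link; set t := l.*2 + 3 in cX cY cZ *.
have t0 : 0 < t by rewrite /t addn3.
have [x0 _] : exists x, x \in X by apply/card_gt0P; rewrite cX.
pose xs := nth x0 (enum X); pose ys := nth x0 (enum Y); pose zs := nth x0 (enum Z).
have nthP (A : {set 'I_n}) k : #|A| = t -> k < t -> nth x0 (enum A) k \in A.
  by move=> cA kt; rewrite -mem_enum mem_nth // -cardE cA.
have nthI (A : {set 'I_n}) i j : #|A| = t -> i < t -> j < t ->
    (nth x0 (enum A) i == nth x0 (enum A) j) = (i == j).
  by move=> cA it jt; rewrite nth_uniq ?enum_uniq // -cardE cA.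
have L i j k : i < t -> j < t -> k < t -> [tuple xs i; ys j; zs k] \in link_triples F S.
  by move=> it jt kt; apply: link; apply: nthP.
have dxy i j : i < t -> j < t -> (xs i == ys j) = false.
  by move=> it jt; case/link_triplesP: (L i j 0 it jt t0) => /and3P[/negbTE].
have dxz i j : i < t -> j < t -> (xs i == zs j) = false.
  by move=> it jt; case/link_triplesP: (L i 0 j it t0 jt) => /and3P[_ /negbTE].
have dyz i j : i < t -> j < t -> (ys i == zs j) = false.
  by move=> it jt; case/link_triplesP: (L 0 i j t0 it jt) => /and3P[_ _ /negbTE].
have Sx i : i < t -> (xs i \in S) = false.
  by move=> it; case/link_triplesP: (L i 0 0 it t0 t0) => _ /and3P[/negbTE].
have Sy i : i < t -> (ys i \in S) = false.
  by move=> it; case/link_triplesP: (L 0 i 0 t0 it t0) => _ /and3P[_ /negbTE].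
have Sz i : i < t -> (zs i \in S) = false.
  by move=> it; case/link_triplesP: (L 0 0 i t0 t0 it) => _ /and3P[_ _ /negbTE].
pose oset (f : nat -> 'I_n) a : {set 'I_n} := if a is Some k then [set f k] else set0.
pose vset (p : option nat * option nat * option nat) :=
  S :|: (oset xs p.1.1 :|: oset ys p.1.2 :|: oset zs p.2).
have memx k p : k < t -> code_bounded t p -> (xs k \in vset p) = (p.1.1 == Some k).
  case: p => [[a b] c] kt /and3P[/= ha hb hc]; rewrite !inE Sx //=.
  case: a b c ha hb hc => [a|] [b|] [c|] /= ha hb hc;
    by rewrite !inE ?nthI ?dxy ?dxz ?orbF //= eq_sym.
have memy k p : k < t -> code_bounded t p -> (ys k \in vset p) = (p.1.2 == Some k).
  case: p => [[a b] c] kt /and3P[/= ha hb hc]; rewrite !inE Sy //=.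
  case: a b c ha hb hc => [a|] [b|] [c|] /= ha hb hc;
    by rewrite !inE ?nthI // ?[ys k == xs _]eq_sym ?dxy ?dyz ?orbF //= eq_sym.
have memz k p : k < t -> code_bounded t p -> (zs k \in vset p) = (p.2 == Some k).
  case: p => [[a b] c] kt /and3P[/= ha hb hc]; rewrite !inE Sz //=.
  case: a b c ha hb hc => [a|] [b|] [c|] /= ha hb hc;
    by rewrite !inE ?nthI // ?[zs k == xs _]eq_sym ?[zs k == ys _]eq_sym
       ?dxz ?dyz ?orbF //= eq_sym.
have oeq (a b : option nat) :
    (forall k, k < t -> (a == Some k) = (b == Some k)) ->
    (if a is Some k then k < t else true) -> (if b is Some k then k < t else true) -> a = b.
  case: a => [a|]; case: b => [b|] // h ha hb.
  - by apply/eqP; rewrite eq_sym -h // eqxx.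
  - by have := h a ha; rewrite eqxx.
  - by have := h b hb; rewrite eqxx.
have vinj p q : code_bounded t p -> code_bounded t q -> vset p = vset q -> p = q.
  move=> bp bq e; have /and3P[p1 p2 p3] := bp; have /and3P[q1 q2 q3] := bq.
  rewrite (surjective_pairing p) (surjective_pairing q).
  rewrite (surjective_pairing p.1) (surjective_pairing q.1).
  congr (_, _, _); apply: oeq => // k kt.
  - by rewrite -!memx ?e.
  - by rewrite -!memy ?e.
  - by rewrite -!memz ?e.
have vsub p q : subcode p q -> vset p \subset vset q.
  have os f a b : a \in [:: None; b] -> oset f a \subset oset f b.
    by rewrite !inE => /orP[] /eqP->; rewrite ?sub0set.
  by case/and3P=> h1 h2 h3; rewrite setUS // !setUSS // os.
have tb i : i < t -> code_bounded t (code_of_triple (crown_triple l i)).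
  by move=> it; have /and3P[h1 h2 h3] := crown_triple_bounded _ _ l1 it; apply/and3P.
have Fp i : i < t -> vset (crown_pair l i) \in F.
  move=> it; have := crown_pair_bounded _ _ l1 it; rewrite /vset.
  case: (crown_pair_shape l i) => -[a [b ->]] /and3P[/= h1 h2 h3].
  - by rewrite setU0; case/link_triplesP: (L a b 0 h1 h2 t0) => _ _ _ /and3P[].
  - by rewrite setU0; case/link_triplesP: (L a 0 b h1 t0 h3) => _ _ _ /and3P[].
  - by rewrite set0U; case/link_triplesP: (L 0 a b t0 h2 h3) => _ _ _ /and3P[].
have Ft i : i < t -> vset (code_of_triple (crown_triple l i)) \in F.
  move=> it; have /and3P[h1 h2 h3] := crown_triple_bounded _ _ l1 it.
  by case/link_triplesP: (L _ _ _ h1 h2 h3).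
have npt i j : crown_pair l i <> code_of_triple (crown_triple l j).
  by move=> e; case: (crown_pair_shape l i) => -[a [b]]; rewrite e.
pose f (u : 'I_t + 'I_t) := match u with
  | inl i => vset (crown_pair l i)
  | inr i => vset (code_of_triple (crown_triple l i)) end.
have pb (i : 'I_t) : code_bounded t (crown_pair l i) by exact: crown_pair_bounded.
apply: (has_crown_map _ _ _ f) => [[i|i] [j|j]|[i|i]|i|i].
- move=> /(vinj _ _ (pb _) (pb _)) e; congr inl; apply/val_inj.
  exact: crown_pair_inj e.
- by move=> /(vinj _ _ (pb _) (tb _ (ltn_ord _))) /npt.
- by move=> /esym /(vinj _ _ (pb _) (tb _ (ltn_ord _))) /npt.
- move=> /(vinj _ _ (tb _ (ltn_ord _)) (tb _ (ltn_ord _))) e; congr inr; apply/val_inj.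
  exact: crown_triple_inj l1 (ltn_ord i) (ltn_ord j) (code_of_triple_inj _ _ e).
- exact: Fp.
- exact: Ft.
- by apply/vsub/subcode_crown.
- by apply/vsub; apply: subcode_crownS.
Qed.

Local Open Scope ring_scope.

(** * Size of crown-free families *)

Lemma has_crown_subset (t n : nat) (F G : {set {set 'I_n}}) :
  F \subset G -> has_crown t F -> has_crown t G.
Proof.
move=> FG /existsP[f /and3P[finj /forallP fF fle]]; apply/existsP; exists f.
by rewrite finj fle andbT; apply/forallP => u; apply: (subsetP FG).
Qed.

(** For [k < K], ['C(n, k) * (n - k) = k.+1 * 'C(n, k.+1)] is at most [K] times the middle binomial,
    and there are [K] such levels. *)
Lemma card_small_sets (T : finType) (K : nat) :
  (#|[set A : {set T} | #|A| < K]| * (#|T| - K) <= K * K * 'C(#|T|, #|T|./2))%N.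
Proof.
have le : (#|[set A : {set T} | #|A| < K]| <= \sum_(k < K) 'C(#|T|, k))%N.
  rewrite -sum1_card.
  under [leqRHS]eq_bigr => k _ do rewrite -card_draws -sum1_card.
  rewrite (exchange_big_dep predT) //= [leqLHS]big_mkcond; apply: leq_sum => A _.
  case: ifP => //; rewrite inE => AK.
  by rewrite (bigD1 (Ordinal AK)) //= inE.
apply: leq_trans (leq_mul le (leqnn _)) _.
rewrite big_distrl /= -mulnA -[K in leqRHS]card_ord -sum_nat_const.
apply: leq_sum => k _; apply: leq_trans (_ : 'C(#|T|, k) * (#|T| - k) <= _)%N.
  by rewrite leq_mul // leq_sub2l // ltnW.
rewrite mulnC -mul_bin_left; apply: leq_mul (bin_le_half _ _).
by rewrite ?card_ord ltn_ord.
Qed.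

(** In the middle level an inclusion is an equality, which contradicts injectivity. *)
Lemma La_crown_ge (t n : nat) : (0 < t)%N -> ('C(n, n./2) <= La_crown t n)%N.
Proof.
move=> t0; rewrite -[X in 'C(X, _)]card_ord -(card_draws 'I_n n./2).
apply: (@leq_bigmax_cond _ _ (fun F : {set {set 'I_n}} => #|F|)).
apply/existsP => -[f /and3P[/injectiveP finj /forallP fF /forallP/(_ (Ordinal t0))]].
move=> /andP[sub _]; suff : @inl 'I_t 'I_t (Ordinal t0) = inr (Ordinal t0) by [].
apply/finj/eqP; rewrite eqEcard sub.
by have := fF (inl (Ordinal t0)); have := fF (inr (Ordinal t0));
  rewrite !inE => /eqP-> /eqP->; rewrite leqnn.
Qed.

(** Discarding the outer levels costs at most [eps / 2] of the middle binomial; the remaining weight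
    above [1 + eps / 2] then forces a complete link, hence a crown. *)
Lemma crown_free_card_le (l : nat) (eps : rat) : (1 < l)%N -> 0 < eps <= 1 ->
  exists N : nat, forall (n : nat) (F : {set {set 'I_n}}), (N <= n)%N ->
    ~~ has_crown (l.*2 + 3) F -> #|F|%:R <= (1 + eps) * ('C(n, n./2))%:R.
Proof.
move=> l1 /andP[e0 e1]; set t := (l.*2 + 3)%N.
have [|K0 link] := complete_link (eps / 6) t; first by apply/andP; split; lra.
have [|K1 _ K1P] := exists_nat_scale (18 * t%:R) eps _ e0; first by rewrite mulr_ge0.
pose K := (K0 + K1 + 2 * t)%N.
have tK : 18 * t%:R <= eps * K%:R.
  by apply: le_trans K1P _; rewrite ler_pM2l // ler_nat /K; lia.
have Kgt0 : (0 < K)%N by rewrite /K /t; lia.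
have [|N1 _ N1P] := exists_nat_scale (4 * (K * K)%:R) eps _ e0; first by rewrite mulr_ge0.
have tK2 : (2 * t <= K)%N by rewrite /K; lia.
have K0K : (K0 <= K)%N by rewrite /K; lia.
move: K tK Kgt0 N1P tK2 K0K => K tK Kgt0 N1P tK2 K0K.
exists (K + N1).+1 => n F nN crF; rewrite leNgt; apply/negP => big.
set C := 'C(n, n./2) in big.
have C0 : 0 < C%:R :> rat by rewrite ltr0n bin_gt0; lia.
pose F' := [set A in F | (K <= #|A|)%N && (K <= #|~: A|)%N].
have FF' : F' \subset F by apply/subsetP => A; rewrite inE => /andP[].
have cF : #|F|%:R <= #|F'|%:R + eps / 2 * C%:R.
  pose Sm := [set A : {set 'I_n} | (#|A| < K)%N].
  have sm : 2 * #|Sm|%:R <= eps / 2 * C%:R.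
    have := card_small_sets 'I_n K; rewrite card_ord -/C -/Sm => h.
    have nK : 0 < (n - K)%:R :> rat by rewrite ltr0n; lia.
    rewrite -(ler_pM2r nK).
    apply: le_trans (_ : 2 * ((K * K)%:R * C%:R) <= _).
      by rewrite -mulrA ler_pM2l // -!natrM ler_nat.
    have : 4 * (K * K)%:R <= eps * (n - K)%:R.
      by apply: le_trans N1P _; rewrite ler_pM2l // ler_nat; lia.
    by rewrite -(ler_pM2r C0); lra.
  apply: le_trans (_ : #|F'|%:R + 2 * #|Sm|%:R <= _); last by rewrite lerD2l.
  rewrite -natrM -natrD ler_nat.
  apply: leq_trans (_ : #|F' :|: (Sm :|: [set ~: A | A in Sm])| <= _)%N.
    apply/subset_leq_card/subsetP => A AF; rewrite !inE AF /=.
    case: (leqP K #|A|) => //= KA; case: (leqP K #|~: A|) => //= KcA.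
    by apply/imsetP; exists (~: A); rewrite ?inE ?setCK.
  apply: leq_trans (leq_card_setU _ _) _; rewrite leq_add2l mul2n -addnn.
  apply: leq_trans (leq_card_setU _ _) _; rewrite leq_add2l.
  by rewrite card_imset //; apply: setC_inj.
have mid A : A \in F' -> (K <= #|A|)%N && (K <= #|~: A|)%N.
  by rewrite inE => /andP[].
have crF' : ~~ has_crown t F' by apply: contra crF; apply: has_crown_subset.
set L := \sum_(B in F') lym_weight B.
have Lbig : 1 + eps / 2 < L.
  apply: lt_le_trans (_ : #|F'|%:R / C%:R <= _).
    by rewrite ltr_pdivlMr //; lra.
  rewrite mulr_natl -sumr_const; apply: ler_sum => B _.
  rewrite lef_pV2 ?posrE // ?ltr0n ?bin_gt0 ?max_card // ler_nat card_ord.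
  exact: bin_le_half.
have F'0 : F' != set0.
  by apply: contraTneq Lbig => e; rewrite /L e big_set0 -leNgt; lra.
have cover (M : {set 'I_n}) : (#|below F' M| < t)%N || (#|above F' M| < t)%N.
  rewrite !ltnNge -negb_and; apply: contra crF' => /andP[].
  exact: has_crown_below_above.
have := sum_lym_le_cover F' t K Kgt0 tK2 mid cover.
rewrite -/L; set p := \sum_(B in F') _ * _ => Lle.
have kap : t%:R / K%:R <= eps / 18.
  by rewrite ler_pdivrMr ?ltr0n //; lra.
have [|S [X [Y [Z [cX cY cZ XYZ]]]]] := link 'I_n F' K K0K mid F'0.
  (* The constants fit because [(1 + eps / 2) * (1 - 2 * eps / 9) >= 1 + eps / 9] for [eps <= 1],
     where [2 / 9 = 1 / 6 + 1 / 18]. *)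
  rewrite -/L -/p.
  have : t%:R / K%:R * (L + 2) <= eps / 18 * (L + 2) by rewrite ler_wpM2r //; lra.
  by nra.
by case/negP: crF'; apply: has_crown_complete cX cY cZ XYZ.
Qed.

(* La(n, O_{2t}) / C(n, floor(n/2)) -> 1 as n -> oo, for every odd t >= 7. *)
Theorem theorem1 (t : nat) (ht : (7 <= t)%N) (hodd : odd t) :
  forall eps : rat, 0 < eps ->
  exists N : nat, forall n : nat, (N <= n)%N ->
    `| (La_crown t n)%:R / ('C(n, n./2))%:R - 1 | <= eps.
Proof.
move=> eps e0.
(* Here [l = (t - 3) / 2] is at least 2 because [t >= 7]. *)
have tE : t = ((t - 3)./2.*2 + 3)%N by lia.
have [||N HN] := crown_free_card_le (t - 3)./2 (Num.min eps 1); first lia.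
  by rewrite lt_min e0 ge_min lexx orbT.
exists N => n nN.
have C0 : 0 < ('C(n, n./2))%:R :> rat by rewrite ltr0n bin_gt0; lia.
(* The empty family is crown-free, so the maximum is attained by a crown-free family. *)
have : (0 < #|[pred F : {set {set 'I_n}} | ~~ has_crown t F]|)%N.
  apply/card_gt0P; exists set0; apply/existsP => -[f /and3P[_ /forallP]].
  by move=> /(_ (inl (Ordinal (leq_trans (isT : 0 < 7)%N ht)))); rewrite inE.
move=> /(eq_bigmax_cond (fun F : {set {set 'I_n}} => #|F|))[F]; rewrite inE => crF.
rewrite -[\max_(_ in _) _]/(La_crown t n) => LaE.
rewrite ger0_norm; last first.
  by rewrite subr_ge0 ler_pdivlMr // mul1r ler_nat La_crown_ge //; lia.
rewrite lerBlDl ler_pdivrMr // LaE; rewrite tE in crF.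
apply: le_trans (HN _ _ nN crF) _.
by rewrite ler_pM2r // lerD2l ge_min lexx.
Qed.
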